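(* Let $X$ be a countable discrete Abelian group containing no elements of order $2$. Let $\alpha$ be an automorphism of the group $X$ satisfying the condition $\mathrm{Ker}(I+\alpha)=\{0\}$. Let $\xi_1$ and $\xi_2$ be independent random variables with values in $X$ and distributions $\mu_1$ and $\mu_2$. If the conditional distribution of the linear form $L_2=\xi_1+\alpha\xi_2$ given $L_1=\xi_1+\xi_2$ is symmetric, then there exist a finite subgroup $K$ of $X$ and elements $x_1,x_2\in X$ such that $\mu_j=m_K*E_{x_j}$, $j=1,2$. Moreover, $\alpha(K)=K$.
   Context: $I$ denotes the identity automorphism of a group. The conditional distribution of $L_2$ given $L_1$ is symmetric if the conditional distributions of $L_2$ given $L_1$ and of $-L_2$ given $L_1$ coincide, equivalently the random pairs $(L_1,L_2)$ and $(L_1,-L_2)$ are identically distributed. $m_K$ denotes the Haar distribution (normalized Haar measure) of a compact subgroup $K$, regarded as a probability distribution on $X$; $E_x$ is the degenerate distribution concentrated at $x\in X$; $*$ is convolution of probability distributions. *)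

(* Defs.v *)
From HB Require Import structures.
From mathcomp Require Import all_boot all_order all_algebra finmap.
From mathcomp Require Import all_classical all_reals all_analysis.

Set Implicit Arguments.
Unset Strict Implicit.
Unset Printing Implicit Defensive.

Import Order.TTheory GRing.Theory Num.Theory.

Local Open Scope classical_set_scope.
Local Open Scope ring_scope.

(** [discrete X] is the group [X] with the discrete topology, of which only the
    Borel sigma-algebra (all subsets) matters for probability distributions. *)
Definition discrete (X : countZmodType) : Type := X.

Section discrete.
Variable X : countZmodType.

HB.instance Definition _ := CountRing.Zmodule.on (discrete X).
HB.instance Definition _ := isPointed.Build (discrete X) 0.
HB.instance Definition _ := @isMeasurable.Build default_measure_display
  (discrete X) discrete_measurable discrete_measurable0
  discrete_measurableC discrete_measurableU.

Lemma measurable_discreteM (A : set (discrete X * discrete X)) : measurable A.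
Proof.
apply: countable_measurable; last exact: countableP.
case=> x y; rewrite (_ : [set _] = [set x] `*` [set y]).
  exact: measurableX.
by apply/seteqP; split=> [_ ->|[_ _] [/= -> ->]].
Qed.

End discrete.

Section probability_on_discrete_group.
Context {R : realType} {X : countZmodType}.
Local Notation DX := (discrete X).

(** Addition is measurable because every subset of [discrete X * discrete X]
    is, by [measurable_discreteM]. *)
Definition convolution (mu nu : set DX -> \bar R) : set DX -> \bar R :=
  pushforward (mu \x nu)%E (fun z : DX * DX => z.1 + z.2).

(** The normalized Haar measure of a finite subgroup is the uniform one; see
    [haarP]. *)
Definition haar (K : {fset DX}) (A : set DX) : \bar R :=
  ((#|` K|%:R^-1)%:E * \sum_(k <- K) \d_k A)%E.

Context {d : measure_display} {Omega : measurableType d}.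
Variable P : probability Omega R.

Definition independent_RV (Y Z : Omega -> DX) : Prop :=
  forall A B : set DX, measurable A -> measurable B ->
    P (Y @^-1` A `&` Z @^-1` B) = (P (Y @^-1` A) * P (Z @^-1` B))%E.

(** Meaningful when [Y = y] has positive probability. *)
Definition cond_distribution (Z Y : Omega -> DX) (y : DX) (B : set DX) : R :=
  fine (P (Y @^-1` [set y] `&` Z @^-1` B)) / fine (P (Y @^-1` [set y])).

Definition cond_symmetric (Z Y : Omega -> DX) : Prop :=
  forall y : DX, P (Y @^-1` [set y]) != 0%E ->
    cond_distribution Z Y y = cond_distribution (fun w => - Z w) Y y.

End probability_on_discrete_group.


Section haarP.
Local Open Scope ereal_scope.
Context {R : realType} {X : countZmodType}.
Local Notation DX := (discrete X).

(** [haar K] is the only probability distribution that is concentrated on [K]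
    and invariant under the translations by elements of [K]. *)
Lemma haarP (K : {fset DX}) (mu : probability DX R) : zmod_closed [in K] ->
  (mu = haar K :> (set DX -> \bar R)) <->
  mu [set` K] = 1 /\
  forall (k : DX) (A : set DX), k \in K -> mu ((fun x => k + x)%R @` A) = mu A.
Proof.
move=> [K0 KB].
have KN k : k \in K -> (- k)%R \in K by move=> kK; rewrite -sub0r KB.
have KD k l : k \in K -> l \in K -> (k + l)%R \in K.
  by move=> kK lK; rewrite -(opprK l) KB// KN.
have cK : (#|` K|%:R : R) != 0%R.
  by rewrite pnatr_eq0 cardfs_eq0; apply/fset0Pn; exists 0%R.
have cardE : \sum_(k <- K) (1 : \bar R) = (#|` K|%:R)%:E.
  by rewrite sumEFin big_const_seq count_predT iter_addr_0.
split=> [muE|[mu1 muD]].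
  split=> [|k A kK]; rewrite muE /haar.
    rewrite [X in _ * X](_ : _ = (#|` K|%:R)%:E) -?EFinM ?mulVf//.
    rewrite -cardE; apply: eq_big_seq => k kK.
    by rewrite diracE mem_set.
  congr (_ * _).
  have pK : perm_eq (map (fun x => k + x)%R K) K.
    apply: uniq_perm => [||x].
    - by rewrite (map_inj_uniq (addrI k)) fset_uniq.
    - exact: fset_uniq.
    apply/mapP/idP => [[y yK ->]|xK].
      exact: (KD k y kK yK).
    by exists (x - k)%R; [exact: (KB x k xK kK)|rewrite addrC subrK].
  rewrite -(perm_big _ pK) big_map; apply: eq_bigr => x _.
  rewrite !diracE; congr ((nat_of_bool _)%:R%:E).
  apply/idP/idP => [/set_mem[y Ay /addrI <-]|/set_mem Ax]; apply: mem_set => //.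
  by exists x.
have muS (B : set DX) : B `<=` [set` K] ->
    mu B = \sum_(k <- K) mu (B `&` [set k]).
  move=> BK; rewrite -measure_fbigsetU//; last first.
    apply/trivIsetP => i j _ _ ij; apply/seteqP; split=> x //= [[_ ->] [_ ji]].
    by move: ij; rewrite ji eqxx.
  congr (mu _); rewrite -bigcup_fset; apply/seteqP; split=> x /=.
    by move=> Bx; exists x; [exact: BK|].
  by case=> k _ [].
have mu1k k : k \in K -> mu [set k] = mu [set 0%R].
  by move=> kK; rewrite -(muD k [set 0%R] kK) image_set1 addr0.
have mu0 : mu [set 0%R] = (#|` K|%:R^-1)%:E.
  have : mu [set` K] = (#|` K|%:R)%:E * mu [set 0%R].
    rewrite muS// -cardE ge0_sume_distrl//; apply: eq_big_seq => k kK.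
    rewrite mul1e -(mu1k k)//; congr (mu _).
    by apply/seteqP; split=> x /=; [case|move=> ->].
  have /fineK <- : mu [set 0%R] \is a fin_num by exact: fin_num_measure.
  rewrite mu1.
  by rewrite -EFinM => -[e]; congr (_%:E); apply: (mulfI cK); rewrite divff.
apply/funext => A; rewrite /haar.
have -> : mu A = mu (A `&` [set` K]).
  have muC : mu (~` [set` K]) = 0 by rewrite probability_setC// mu1 subee.
  rewrite -[in LHS](setIT A) -(setUv [set` K]) setIUr measureU//; last first.
    by rewrite setIACA setICr setI0.
  rewrite [X in _ + X](subset_measure0 _ _ _ muC) ?adde0//.
rewrite muS; last exact: subIsetr.
rewrite ge0_sume_distrr//; apply: eq_big_seq => k kK.
rewrite diracE; have [kA|kA] := boolP (k \in A).
  rewrite mule1 -mu0 -(mu1k k)//; congr (mu _).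
  apply/seteqP; split=> x /=; first by case.
  by move=> ->; split=> //; split=> //; exact: set_mem.
rewrite mule0 [X in mu X](_ : _ = set0) ?measure0//.
apply/seteqP; split=> x //= [[Ax _] xk]; move: kA; rewrite -xk.
by apply/negP/negPn; exact: mem_set.
Qed.

End haarP.

Section cond_symmetricP.
Local Open Scope ereal_scope.
Context {R : realType} {X : countZmodType}.
Local Notation DX := (discrete X).
Context {d : measure_display} {Omega : measurableType d}.
Variable P : probability Omega R.

(** Symmetry of the conditional distribution of [Z] given [Y] amounts to
    [(Y, Z)] and [(Y, - Z)] being identically distributed. *)
Lemma cond_symmetricP (Y Z : {RV P >-> DX}) :
  cond_symmetric P Z Y <->
  forall B : set (DX * DX),
    P ((fun w => (Y w, Z w)) @^-1` B) = P ((fun w => (Y w, - Z w)%R) @^-1` B).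
Proof.
have mS (V : {RV P >-> DX}) (B : set DX) : measurable (V @^-1` B).
  by rewrite -[X in measurable X]setTI; exact: measurable_funP.
have mN (B : set DX) : measurable ((fun w => - Z w)%R @^-1` B).
  exact: (mS Z ((fun x => - x)%R @^-1` B)).
split=> [sym B|eqP y Py]; last first.
  apply/funext => B; rewrite /cond_distribution; congr (fine _ / _)%R.
  exact: (eqP ([set y] `*` B)).
pose Yn n := [set y : DX | choice.pickle y = n].
pose Bn n := [set z : DX | exists2 y : DX, choice.pickle y = n & B (y, z)].
have sumE (V : Omega -> DX) : (forall A, measurable (V @^-1` A)) ->
    P ((fun w => (Y w, V w)) @^-1` B) =
    \sum_(n <oo) P (Y @^-1` Yn n `&` V @^-1` Bn n).
  move=> mV; have mYV n : measurable (Y @^-1` Yn n `&` V @^-1` Bn n).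
    exact: measurableI.
  rewrite -measure_semi_bigcup//; last 2 first.
    apply/trivIsetP => i j _ _ ij; apply/seteqP; split=> w //= [[iw _] [jw _]].
    by move: ij; rewrite -iw -jw eqxx.
    exact: bigcup_measurable.
  congr (P _); apply/seteqP; split=> w /=.
    by move=> Bw; exists (choice.pickle (Y w)) => //=; split=> //; exists (Y w).
  by case=> n _ [/= <-] [y /(pcan_inj choice.pickleK) ->].
rewrite !sumE//; apply: eq_eseriesr => n _.
have [[y yn]|Y0] := pselect (exists y : DX, choice.pickle y = n); last first.
  congr (P _); apply/seteqP; split=> w /= [Yw _]; exfalso; apply: Y0;
    by exists (Y w).
have -> : Yn n = [set y].
  apply/seteqP; split=> x /=; rewrite /Yn/= -yn; last by move=> ->.
  exact: pcan_inj choice.pickleK _ _.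
have [P0|P0] := eqVneq (P (Y @^-1` [set y])) 0.
  have P0A (A : set Omega) : measurable A -> P (Y @^-1` [set y] `&` A) = 0.
    move=> mA; apply: (subset_measure0 _ _ _ P0) => //.
    exact: measurableI.
  by rewrite !P0A.
have /(congr1 (fun f => f (Bn n))) := sym y P0.
rewrite /cond_distribution => /mulIf e.
have fin A : measurable A -> P A \is a fin_num by exact: fin_num_measure.
rewrite -[LHS]fineK; last by apply: fin; exact: measurableI.
rewrite -[RHS]fineK; last by apply: fin; exact: measurableI.
by congr EFin; apply: e; rewrite invr_eq0 fine_eq0//; exact: fin.
Qed.

End cond_symmetricP.

(* Main.v *)
Require Import Defs.
From HB Require Import structures.
From mathcomp Require Import all_boot all_order all_algebra finmap.
From mathcomp Require Import all_classical all_reals all_analysis.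
From mathcomp Require Import lra.

Set Implicit Arguments.
Unset Strict Implicit.
Unset Printing Implicit Defensive.

Import Order.TTheory GRing.Theory Num.Theory.

Local Open Scope classical_set_scope.
Local Open Scope ring_scope.

(** Taking [L1 - L2] and [alpha L1 - L2] on both sides of the equality in law
    of [(L1, L2)] and [(L1, - L2)] gives two equalities in law:
    - [(I - alpha) xi2] and [2 xi1 + (I + alpha) xi2],
    - [(alpha - I) xi1] and [2 alpha xi2 + (I + alpha) xi1].
    Here the endomorphisms [2], [2 alpha] and [I + alpha] are injective.  Both
    equalities are of the form [chi V ~ phi U + psi V], with [U], [V]
    independent and [phi], [psi] injective, and this form is very rigid, because
    [chi] can only make atoms heavier whereas adding an independent variable can
    only make the heaviest atom lighter.

    Precisely, let [y0] be a heaviest atom of [V], of mass [M].  Then [chi y0]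
    has mass at least [M] for [chi V].  On the other side its mass is the
    average, for the law of [U], of masses of atoms of [V], so all of
    these masses must be [M]: every [x] in the support of [U] yields an atom [y]
    of [V] of mass [M] such that [phi x + psi y = chi y0] ([max_atom_shift]).
    As [phi] is injective, these [y] are distinct, so the support of [U] has at
    most [1 / M] points ([card_supp_le]).  With the same bound for the support
    of [V], this forces [xi1] and [xi2] to be uniform on finite sets [S] and [T]
    of the same cardinal ([uniform_pair]).  Now every point of [T] is a heaviest
    atom, and applying [max_atom_shift] to all of them shows that [S] is
    closed under [x - y + z], hence is a coset [x1 + K] ([supp_affine]);
    likewise [T] is a coset [x2 + L].

    It remains to see that [K = L = alpha K].  The support of [(L1, L2)] is
    invariant under [(s, t) |-> (s, - t)].  Up to translation this means that
    every [k] in [K] is both [a + b] and [- (a + alpha b)], with [a] in [K] and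
    [b] in [L].  Then [b] and [alpha b] are in [K] and
    [2 k = b - alpha b], so that [b] determines [k]; as [K] and [L] have the
    same cardinal, all elements [b] of [L] occur ([subgroups_eq_stable]). *)

(** * Cardinals of finite sets *)

Lemma sum_fset_const (R : nzRingType) (T : choiceType) (F : {fset T}) (c : R) :
  \sum_(x <- F) c = #|` F|%:R * c.
Proof. by rewrite big_const_seq count_predT iter_addr addr0 mulr_natl. Qed.

(** The bound on the finite subsets of [p] bounds its cardinal by [c^-1]. *)
Lemma fset_of_card_bound (R : realType) (T : choiceType) (p : pred T) (c : R) :
    0 < c ->
    (forall F : {fset T}, {in F, forall x, p x} -> #|` F|%:R * c <= 1) ->
  exists S : {fset T}, S =i p.
Proof.
move=> c0 pc; have /finite_fsetP[S SE] : finite_set [set x | p x].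
  apply: contrapT => /infinite_set_fset.
  move=> /(_ (Num.truncn c^-1).+1)[F Fp nF].
  have Fc : #|` F|%:R * c <= 1 by apply: pc => x; exact: Fp.
  have : c^-1 < #|` F|%:R.
    by apply: (lt_le_trans (truncnS_gt _)); rewrite ler_nat.
  by rewrite ltNge -[leRHS]mul1r ler_pdivlMr// Fc.
exists S => x.
by move/(congr1 (@^~ x)): SE => /= SE; apply/idP/idP; rewrite -topredE/= SE.
Qed.

(** * Finite sets stable under ternary differences *)

Section affine_fsets.
Context {X : countZmodType}.
Local Notation DX := (discrete X).

(** For fixed [t0] in [T], the relation [phi u + psi v = chi t0] is a bijection
    from [S] to [T], so that [psi T] is [chi t0 - phi S].  On the other hand the
    hypotheses make [psi T] stable under the translations by [phi y - phi z],
    for [y] and [z] in [S]; hence so is [phi S]. *)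
Lemma shift_affine (S T : {fset DX}) (phi psi chi : DX -> DX) :
    #|` S| = #|` T| ->
    (forall x y z, phi (x - y + z) = phi x - phi y + phi z) ->
    injective phi -> injective psi ->
    {in S & T, forall x y, exists2 z, z \in T & phi x + psi y = chi z} ->
    {in S & T, forall x z, exists2 y, y \in T & phi x + psi y = chi z} ->
  {in S & &, forall x y z, x - y + z \in S}.
Proof.
move=> ST phiA phiI psiI fwd bwd x y z xS yS zS.
have /fset0Pn[t0 t0T] : T != fset0.
  by rewrite -cardfs_gt0 -ST cardfs_gt0; apply/fset0Pn; exists x.
have /choice[f fP] u : exists v, u \in S -> v \in T /\ phi u + psi v = chi t0.
  have [uS|uS] := boolP (u \in S); last by exists 0.
  by have [v] := bwd u t0 uS t0T; exists v.
have fI : {in S &, injective f}.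
  move=> u v /fP[_ e] /fP[_ e'] uv; apply: phiI.
  by apply: (addIr (psi (f u))); rewrite e uv e'.
have fST : [fset f u | u in S]%fset = T.
  apply/eqP; rewrite eqEfcard card_in_imfset// ST leqnn andbT.
  by apply/fsubsetP => _ /imfsetP[u /= /fP[? _] ->].
have [t tT e1] := fwd _ _ yS (fP x xS).1.
have [s + e2] := bwd z t zS tT.
rewrite -fST => /imfsetP[u /= uS sE].
have [_ e3] := fP u uS; have [_ e4] := fP x xS.
suff <- : u = x - y + z by [].
apply: phiI; rewrite phiA.
apply: (addIr (psi (f u))); rewrite e3 -e4 -sE -!addrA; congr (_ + _).
by rewrite e2 -e1 addKr.
Qed.

Lemma translate_zmod_closed (S : {fset DX}) (x0 : DX) : x0 \in S ->
    {in S & &, forall x y z, x - y + z \in S} ->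
  zmod_closed [in [fset x - x0 | x in S]%fset].
Proof.
move=> x0S affS; split.
  by apply/imfsetP; exists x0; rewrite //= subrr.
move=> _ _ /imfsetP[x /= xS ->] /imfsetP[y /= yS ->].
apply/imfsetP; exists (x - y + x0); first exact: affS.
by rewrite addrK opprB addrA subrK.
Qed.

(** In the decomposition of [k], [b = k - a] and [alpha b = - k - a] are in [K],
    and [b] determines [k] since [2 k = b - alpha b].  So [k |-> b] is injective
    from [K] to [L], hence onto [L], and both [L] and [alpha L] are in [K]; they
    are equal to [K] since all these sets have the same cardinal. *)
Lemma subgroups_eq_stable (K L : {fset DX}) (alpha : {additive DX -> DX}) :
    #|` K| = #|` L| -> injective alpha ->
    (forall x : DX, x *+ 2 = 0 -> x = 0) -> zmod_closed [in K] ->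
    {in K, forall k, exists a b : DX,
      [/\ a \in K, b \in L, k = a + b & k = - (a + alpha b)]} ->
  L = K /\ [fset alpha x | x in K]%fset = K.
Proof.
move=> KL alphaI tors [K0 KB] split_K.
have KN x : x \in K -> - x \in K by move=> xK; rewrite -sub0r KB.
have /choice[f fP] k : exists b, k \in K ->
    [/\ b \in L, b \in K, alpha b \in K & k *+ 2 = b - alpha b].
  have [kK|kK] := boolP (k \in K); last by exists 0.
  have [a [b [aK bL kE kE']]] := split_K k kK.
  exists b => _; split=> //.
  - by rewrite -(addKr a b) -kE addrC; apply: KB.
  - have -> : alpha b = - k - a by rewrite kE' opprK addrC addKr.
    by apply: KB => //; exact: KN.
  - by rewrite mulr2n {1}kE kE' opprD addrACA subrr add0r.
have fI : {in K &, injective f}.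
  move=> k l /fP[_ _ _ ek] /fP[_ _ _ el] kl; apply/eqP; rewrite -subr_eq0.
  by apply/eqP/tors; rewrite mulrnBl ek el kl subrr.
have fK : [fset f k | k in K]%fset = L.
  apply/eqP; rewrite eqEfcard card_in_imfset// KL leqnn andbT.
  by apply/fsubsetP => _ /imfsetP[k /= /fP[? _ _ _] ->].
have LK : L = K.
  apply/eqP; rewrite eqEfcard KL leqnn andbT -fK.
  by apply/fsubsetP => _ /imfsetP[k /= /fP[_ ? _ _] ->].
split=> //; apply/eqP; rewrite eqEfcard card_imfset// leqnn andbT.
apply/fsubsetP => _ /imfsetP[b /= + ->].
by rewrite -{1}LK -fK => /imfsetP[k /= /fP[_ _ ? _] ->].
Qed.

End affine_fsets.

(** * Atoms of discrete random variables *)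

Section random_variables.
Context {R : realType} {X : countZmodType}.
Local Notation DX := (discrete X).
Context {d : measure_display} {Omega : measurableType d}.
Variable P : probability Omega R.

Definition atom (U : Omega -> DX) (x : DX) : R := fine (P (U @^-1` [set x])).

Lemma measurable_RV (U : {RV P >-> DX}) (A : set DX) : measurable (U @^-1` A).
Proof. by rewrite -[X in measurable X]setTI; exact: measurable_funP. Qed.

Lemma measurable_RV2 (U V : {RV P >-> DX}) (B : set (DX * DX)) :
  measurable ((fun w => (U w, V w)) @^-1` B).
Proof.
have mUV : measurable_fun setT (fun w => (U w, V w)).
  by apply/measurable_fun_pair; exact: measurable_funP.
rewrite -[X in measurable X]setTI; apply: mUV => //.
exact: measurable_discreteM.
Qed.

Lemma atomE (U : {RV P >-> DX}) x : P (U @^-1` [set x]) = (atom U x)%:E.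
Proof. by rewrite fineK// fin_num_measure//; exact: measurable_RV. Qed.

Lemma atom_ge0 (U : Omega -> DX) x : 0 <= atom U x.
Proof. exact: fine_ge0. Qed.

(** Since [X] is countable, the inequality can be summed over the fibers of [U].
    It says that conditioning on each value of [U] gives [E] a probability at
    most [M]. *)
Lemma prob_le_fibers (U : {RV P >-> DX}) (A : set DX) (E : set Omega) (M : R) :
    measurable E ->
    (forall x, A x ->
      P (U @^-1` [set x] `&` E) <= M%:E * P (U @^-1` [set x]))%E ->
  (P (U @^-1` A `&` E) <= M%:E * P (U @^-1` A))%E.
Proof.
move=> mE ub; pose An n := A `&` [set x : DX | choice.pickle x = n].
have AE : A = \bigcup_n An n.
  by apply/seteqP; split=> [x Ax|x [n _ []]//]; exists (choice.pickle x).
have sumE F : measurable F ->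
    P (U @^-1` A `&` F) = (\sum_(n <oo) P (U @^-1` An n `&` F))%E.
  move=> mF; have mAn n : measurable (U @^-1` An n `&` F).
    by apply: measurableI => //; exact: measurable_RV.
  rewrite [in LHS]AE preimage_bigcup setI_bigcupl measure_semi_bigcup//.
    apply/trivIsetP => i j _ _ ij; apply/seteqP; split=> w //=.
    move=> [[[_ iw] _] [[_ jw] _]].
    by move: ij; rewrite -iw -jw eqxx.
  exact: bigcup_measurable.
rewrite sumE// -[X in (_ * P X)%E]setIT sumE// -nneseriesZl; last by [].
apply: lee_nneseries => // n _; rewrite setIT.
have [[x [Ax xn]]|A0] := pselect (exists x, An n x); last first.
  have -> : An n = set0 by apply/seteqP; split=> // x Ax; apply: A0; exists x.
  by rewrite preimage_set0 set0I measure0 mule0.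
have -> : An n = [set x].
  apply/seteqP; split=> [y [_ yn]|_ ->]; last by [].
  by apply: (pcan_inj choice.pickleK); rewrite yn.
exact: ub.
Qed.

(** An average of numbers at most [M] reaches [M] only if all the numbers of
    nonzero weight are equal to [M]. *)
Lemma prob_le_fibers_eq (U : {RV P >-> DX}) (E : set Omega) (M : R) :
    measurable E -> (M%:E <= P E)%E ->
    (forall x, P (U @^-1` [set x] `&` E) <= M%:E * P (U @^-1` [set x]))%E ->
  forall x, P (U @^-1` [set x] `&` E) = (M%:E * P (U @^-1` [set x]))%E.
Proof.
move=> mE ME ub x; apply/eqP; rewrite eq_le ub/=.
have /= := @prob_le_fibers U (~` [set x]) E M mE (fun y _ => ub y).
rewrite -preimage_setC probability_setC; last exact: measurable_RV.
have mxE : measurable (U @^-1` [set x] `&` E).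
  by apply: measurableI => //; exact: measurable_RV.
have mxE' : measurable (~` (U @^-1` [set x]) `&` E).
  by apply: measurableI => //; apply: measurableC; exact: measurable_RV.
have PE : P E = (P (U @^-1` [set x] `&` E) + P (~` (U @^-1` [set x]) `&` E))%E.
  rewrite -measureU//; last by rewrite setIACA setICr set0I.
  by rewrite -setIUl setUv setTI.
move: ME; rewrite PE atomE.
rewrite -(fineK (fin_num_measure P _ mxE)) -(fineK (fin_num_measure P _ mxE')).
rewrite -EFinD -EFinB -!EFinM !lee_fin; lra.
Qed.

Lemma prob_fset (U : {RV P >-> DX}) (F : {fset DX}) :
  P (U @^-1` [set` F]) = (\sum_(x <- F) atom U x)%:E.
Proof.
rewrite -sumEFin; under eq_bigr do rewrite -atomE.
rewrite -measure_fbigsetU; last 2 first.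
- by move=> x _; exact: measurable_RV.
- by move=> x y _ _ [w [/= <- <-]].
congr (P _); rewrite -bigcup_fset; apply/seteqP; split=> w /=.
  by move=> wF; exists (U w).
by case=> x xF ->.
Qed.

Lemma sum_atom_le1 (U : {RV P >-> DX}) (F : {fset DX}) :
  \sum_(x <- F) atom U x <= 1.
Proof.
by rewrite -lee_fin -prob_fset probability_le1//; exact: measurable_RV.
Qed.

Lemma card_large_atoms (U : {RV P >-> DX}) (F : {fset DX}) (c : R) :
  (forall x, x \in F -> c <= atom U x) -> #|` F|%:R * c <= 1.
Proof.
move=> cF; apply: le_trans (sum_atom_le1 U F).
rewrite -sum_fset_const big_seq [leRHS]big_seq.
exact: ler_sum.
Qed.

Lemma fiber_gt0 (U : {RV P >-> DX}) (E : set Omega) : measurable E ->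
  (0 < P E)%E -> exists x, (0 < P (U @^-1` [set x] `&` E))%E.
Proof.
move=> mE PE; apply: contrapT => U0; move: PE; rewrite ltNge => /negP; apply.
rewrite -[E]setTI -(preimage_setT U) -[leRHS](mul0e (P (U @^-1` setT))).
apply: prob_le_fibers => // x _; rewrite mul0e leNgt.
by apply/negP => x0; apply: U0; exists x.
Qed.

Lemma prob_gt0_atoms (U V : {RV P >-> DX}) (B : set (DX * DX)) :
    (0 < P ((fun w => (U w, V w)) @^-1` B))%E ->
  exists x y, [/\ B (x, y), 0 < atom U x & 0 < atom V y].
Proof.
have mB := measurable_RV2 U V B.
move=> /(fiber_gt0 U mB)[x]; set E := _ `&` _ => Ex.
have mE : measurable E by apply: measurableI => //; exact: measurable_RV.
have [y Ey] := fiber_gt0 V mE Ex.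
have mF : measurable (V @^-1` [set y] `&` E).
  by apply: measurableI => //; exact: measurable_RV.
exists x, y; split.
- have /set0P[w [/= <- [/= <-]]//] : V @^-1` [set y] `&` E != set0.
  by apply: contraTneq Ey => ->; rewrite measure0 ltxx.
- rewrite -lte_fin -atomE; apply: (lt_le_trans Ex).
  by apply: le_measure; rewrite ?inE//; do ?exact: measurable_RV; move=> w [].
- rewrite -lte_fin -atomE; apply: (lt_le_trans Ey).
  by apply: le_measure; rewrite ?inE//; do ?exact: measurable_RV; move=> w [].
Qed.

Lemma atom_gt0_ex (U : {RV P >-> DX}) : exists x, 0 < atom U x.
Proof.
have [|x [y [_ x_gt0 _]]] := @prob_gt0_atoms U U setT; last by exists x.
by rewrite preimage_setT probability_setT.
Qed.

(** Only finitely many atoms are at least as heavy as a given atom of positive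
    mass, and the maximum is taken over these. *)
Lemma atom_max_ex (U : {RV P >-> DX}) :
  exists2 y, 0 < atom U y & forall x, atom U x <= atom U y.
Proof.
have [x0 x0_gt0] := atom_gt0_ex U.
pose p := [pred x : DX | atom U x0 <= atom U x].
have [F Fx] : exists F : {fset DX}, F =i p.
  apply: (fset_of_card_bound x0_gt0) => F Fp.
  exact: (card_large_atoms (U := U)).
have x0F : x0 \in F by rewrite Fx inE.
have [y _ ymax] := @arg_maxP _ _ F [` x0F]%fset xpredT (atom U \o val) isT.
have /[!(Fx, inE)] yF := valP y.
exists (val y); first exact: lt_le_trans yF.
move=> x; have [xF|xF] := boolP (x \in F); first exact: (ymax [` xF]%fset).
by move: xF; rewrite Fx inE -ltNge => /ltW/le_trans; apply.
Qed.

Lemma prob_off_supp (U : {RV P >-> DX}) (A : set DX) :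
  (forall x, A x -> ~ 0 < atom U x) -> P (U @^-1` A) = 0%E.
Proof.
move=> A0; apply/eqP; apply: contraT; rewrite -measure_gt0.
by move=> /(@prob_gt0_atoms U U [set z | A z.1])[x [y [/= /A0]]].
Qed.

Lemma sum_atom_supp (U : {RV P >-> DX}) (S : {fset DX}) :
  (forall x, 0 < atom U x -> x \in S) -> \sum_(x <- S) atom U x = 1.
Proof.
move=> suppS; have := probability_setC P (measurable_RV U [set` S]).
rewrite prob_fset preimage_setC prob_off_supp => [/esym/eqP|x /= xS].
  by rewrite -EFinB eqe subr_eq0 => /eqP.
by apply: contra_not xS; exact: suppS.
Qed.

Lemma pair_gt0 (U V : {RV P >-> DX}) (B : set (DX * DX)) (x y : DX) :
    independent_RV P U V -> 0 < atom U x -> 0 < atom V y -> B (x, y) ->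
  (0 < P ((fun w => (U w, V w)) @^-1` B))%E.
Proof.
move=> UV Ux Vy Bxy.
have : (0 < P (U @^-1` [set x] `&` V @^-1` [set y]))%E.
  by rewrite UV// !atomE -EFinM lte_fin mulr_gt0.
move/lt_le_trans; apply; apply: le_measure; rewrite ?inE.
- by apply: measurableI; exact: measurable_RV.
- exact: measurable_RV2.
- by move=> w /= [-> ->].
Qed.

(** * Equidistribution of [chi V] and [phi U + psi V] *)

(** Equality of the laws, since a law on a countable set is given by its
    atoms. *)
Definition same_law (Y Z : Omega -> DX) : Prop :=
  forall z, P (Y @^-1` [set z]) = P (Z @^-1` [set z]).

Definition uniform_on (U : Omega -> DX) (S : {fset DX}) : Prop :=
  forall x, atom U x = (x \in S)%:R / #|` S|%:R.

Lemma uniform_on_gt0 (U : {RV P >-> DX}) (S : {fset DX}) (x : DX) :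
  uniform_on U S -> (0 < atom U x) = (x \in S).
Proof.
move=> ->; have [xS|xS] := boolP (x \in S); last by rewrite mul0r ltxx.
by rewrite mul1r invr_gt0 ltr0n cardfs_gt0; apply/fset0Pn; exists x.
Qed.

(** Given [U = x], the event [phi U + psi V = chi y0] amounts to [V = y] for at
    most one [y], so its conditional probability is at most the mass of [y0].
    But its total probability is at least that mass, since it is the probability
    of [chi V = chi y0].  So equality holds for all the values [x] that [U]
    takes. *)
Lemma max_atom_shift (U V : {RV P >-> DX}) (phi psi chi : DX -> DX) (y0 : DX) :
    independent_RV P U V -> injective psi ->
    same_law (chi \o V) (fun w => phi (U w) + psi (V w)) ->
    (forall y, atom V y <= atom V y0) ->
  forall x, 0 < atom U x ->
    exists2 y, atom V y = atom V y0 & phi x + psi y = chi y0.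
Proof.
move=> UV psiI law y0_max a a0.
pose E := (fun w => phi (U w) + psi (V w)) @^-1` [set chi y0].
pose B x := [set y : DX | phi x + psi y = chi y0].
have PE x : P (U @^-1` [set x] `&` E) = ((atom U x)%:E * P (V @^-1` B x))%E.
  rewrite -atomE -UV//; congr (P _); apply/seteqP.
  by split=> w /= [Uw]; rewrite /E /B/= Uw.
have B1 x : B x = set0 \/ exists y, B x = [set y].
  have [[y Bxy]|B0] := pselect (exists y, B x y); last first.
    by left; apply/seteqP; split=> // y Bxy; apply: B0; exists y.
  right; exists y; apply/seteqP; split=> [z|z -> //]; rewrite /B/= -Bxy.
  by move=> /addrI /psiI.
have mE : measurable E.
  exact: (measurable_RV2 U V [set z | phi z.1 + psi z.2 = chi y0]).
have ME : ((atom V y0)%:E <= P E)%E.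
  rewrite -atomE -law.
  apply: le_measure; rewrite ?inE; first exact: measurable_RV.
    exact: (measurable_RV V (chi @^-1` [set chi y0])).
  by move=> w /= ->.
have ub x : (P (U @^-1` [set x] `&` E) <=
    (atom V y0)%:E * P (U @^-1` [set x]))%E.
  rewrite PE atomE muleC lee_wpmul2r ?lee_fin ?atom_ge0//.
  have [->|[y ->]] := B1 x; last by rewrite atomE lee_fin.
  by rewrite preimage_set0 measure0 lee_fin atom_ge0.
have := prob_le_fibers_eq mE ME ub a; rewrite PE atomE.
have y0_gt0 : 0 < atom V y0.
  by have [y y_gt0] := atom_gt0_ex V; exact: lt_le_trans (y0_max y).
have [->|[y By]] := B1 a.
  rewrite preimage_set0 measure0 mule0 -EFinM => -[/esym/eqP].
  by rewrite mulf_eq0 !gt_eqF.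
rewrite By atomE -!EFinM mulrC => -[/(mulIf (lt0r_neq0 a0)) Vy].
by exists y => //; have : B a y by rewrite By.
Qed.

(** The map sending [x] to the heaviest atom [y] of [V] such that
    [phi x + psi y = chi y0] is injective, and [V] cannot have more than
    [(atom V y0)^-1] heaviest atoms. *)
Lemma card_supp_le (U V : {RV P >-> DX}) (phi psi chi : DX -> DX) (y0 : DX) :
    independent_RV P U V -> injective phi -> injective psi ->
    same_law (chi \o V) (fun w => phi (U w) + psi (V w)) ->
    (forall y, atom V y <= atom V y0) ->
  forall F : {fset DX}, {in F, forall x, 0 < atom U x} ->
    #|` F|%:R * atom V y0 <= 1.
Proof.
move=> UV phiI psiI law y0_max F FU.
have /choice[f fP] x : exists y, 0 < atom U x ->
    atom V y = atom V y0 /\ phi x + psi y = chi y0.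
  have [x0|x0] := ltP 0 (atom U x); last by exists 0.
  by have [y] := max_atom_shift UV psiI law y0_max x0; exists y.
have fI : {in F &, injective f}.
  move=> x x' /FU/fP[_ e] /FU/fP[_ e'] ff; apply: phiI.
  by apply: (addIr (psi (f x))); rewrite e ff e'.
rewrite -(card_in_imfset imfset_key fI).
apply: (card_large_atoms (U := V)) => _ /imfsetP[x /= xF ->].
by have [-> _] := fP x (FU x xF).
Qed.

(** The masses of the points of [S] sum to [1] and are at most [M], with
    [#|` S| * M] at most [1], so they are all equal to [M]. *)
Lemma uniform_on_of_card (U : {RV P >-> DX}) (S : {fset DX}) (M : R) :
    S =i [pred x | 0 < atom U x] -> (forall x, atom U x <= M) ->
    #|` S|%:R * M <= 1 ->
  uniform_on U S.
Proof.
move=> SU UM SM.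
have S1 := @sum_atom_supp U S (fun x => etrans (SU x)).
have S_gt0 : 0 < #|` S|%:R :> R.
  rewrite ltr0n cardfs_gt0; apply/eqP => S0.
  by move/eqP: S1; rewrite S0 big_seq_fset0 eq_sym oner_eq0.
have sum0 : \sum_(x <- S) (M - atom U x) <= 0.
  by rewrite sumrB sum_fset_const S1 subr_le0.
have atomM x : x \in S -> atom U x = M.
  move=> xS; apply/eqP; rewrite eq_sym -subr_eq0 eq_le subr_ge0 UM andbT.
  apply: le_trans sum0; rewrite (big_fsetD1 x)//= lerDl sumr_ge0// => y _.
  by rewrite subr_ge0.
have ME : M = #|` S|%:R^-1.
  apply: (mulfI (lt0r_neq0 S_gt0)); rewrite divff ?gt_eqF// -sum_fset_const -S1.
  by rewrite big_seq [RHS]big_seq; apply: eq_bigr => x /atomM.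
move=> x; have [xS|xS] := boolP (x \in S); first by rewrite atomM// mul1r.
rewrite mul0r; apply/eqP; rewrite eq_le atom_ge0 andbT.
by move: xS; rewrite SU inE -leNgt.
Qed.

(** Let [m] and [n] be the cardinals of the supports, and [p] and [q] the masses
    of the heaviest atoms.  Then [m q <= 1 <= n q] and [n p <= 1 <= m p], hence
    [m = n] and [p = q = m^-1]. *)
Lemma uniform_pair (U V : {RV P >-> DX}) (x0 y0 : DX) :
    0 < atom U x0 -> 0 < atom V y0 ->
    (forall x, atom U x <= atom U x0) -> (forall y, atom V y <= atom V y0) ->
    (forall F : {fset DX}, {in F, forall x, 0 < atom U x} ->
      #|` F|%:R * atom V y0 <= 1) ->
    (forall F : {fset DX}, {in F, forall x, 0 < atom V x} ->
      #|` F|%:R * atom U x0 <= 1) ->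
  exists S T : {fset DX},
    [/\ #|` S| = #|` T|, uniform_on U S & uniform_on V T].
Proof.
move=> x0_gt0 y0_gt0 x0_max y0_max cU cV.
have [S SU] := fset_of_card_bound y0_gt0 cU.
have [T TV] := fset_of_card_bound x0_gt0 cV.
have lb (W : {RV P >-> DX}) (F : {fset DX}) z :
    F =i [pred x | 0 < atom W x] ->
    (forall x, atom W x <= atom W z) -> 1 <= #|` F|%:R * atom W z.
  move=> FW zmax; have suppF x : 0 < atom W x -> x \in F by rewrite FW inE.
  by rewrite -{1}(sum_atom_supp suppF) -sum_fset_const ler_sum.
have cS : #|` S|%:R * atom V y0 <= 1 by apply: cU => x; rewrite SU.
have cT : #|` T|%:R * atom U x0 <= 1 by apply: cV => x; rewrite TV.
have ST : #|` S| = #|` T|.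
  apply/eqP; rewrite eqn_leq -!(ler_nat R); apply/andP; split.
    by rewrite -(ler_pM2r y0_gt0) (le_trans cS)// lb.
  by rewrite -(ler_pM2r x0_gt0) (le_trans cT)// lb.
exists S, T; split => //.
  by apply: (uniform_on_of_card SU x0_max); rewrite ST.
by apply: (uniform_on_of_card TV y0_max); rewrite -ST.
Qed.

(** This is [shift_affine]: the supports of the two sides coincide, and every
    point of the support of a uniform law is a heaviest atom, to which
    [max_atom_shift] applies. *)
Lemma supp_affine (U V : {RV P >-> DX}) (phi psi chi : DX -> DX)
    (S T : {fset DX}) :
    independent_RV P U V -> injective phi -> injective psi ->
    same_law (chi \o V) (fun w => phi (U w) + psi (V w)) ->
    (forall x y z, phi (x - y + z) = phi x - phi y + phi z) ->
    uniform_on U S -> uniform_on V T -> #|` S| = #|` T| ->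
  {in S & &, forall x y z, x - y + z \in S}.
Proof.
move=> UV phiI psiI law phiA US VT ST.
apply: (shift_affine ST phiA phiI psiI (chi := chi)) => [x y|x z].
  rewrite -(uniform_on_gt0 _ US) -(uniform_on_gt0 _ VT) => xS yT.
  have : (0 < P ((fun w => phi (U w) + psi (V w))%R @^-1`
      [set (phi x + psi y)%R]))%E.
    exact: (pair_gt0 (B := [set z | phi z.1 + psi z.2 = phi x + psi y])
      UV xS yT).
  rewrite -law.
  move=> /(@prob_gt0_atoms V V [set z | chi z.2 = phi x + psi y]).
  by move=> [_ [z [/= zE _ zT]]]; exists z; rewrite // -(uniform_on_gt0 _ VT).
rewrite -(uniform_on_gt0 _ US) => xS zT.
have z_max y : atom V y <= atom V z.
  by rewrite !VT zT ler_wpM2r// ?invr_ge0// ler_nat leq_b1.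
have [y yz yE] := max_atom_shift UV psiI law z_max xS.
by exists y; rewrite // -(uniform_on_gt0 _ VT) yz (uniform_on_gt0 _ VT).
Qed.

(** * Uniform laws on cosets *)

Section pair_RV.
Variables (U V : {RV P >-> DX}) (f : DX -> DX -> DX).

Definition pair_RV (w : Omega) : DX := f (U w) (V w).

Let measurable_pair_RV : measurable_fun setT pair_RV.
Proof.
move=> _ B _; rewrite setTI.
exact: (measurable_RV2 U V [set z | B (f z.1 z.2)]).
Qed.

HB.instance Definition _ :=
  isMeasurableFun.Build _ _ _ _ pair_RV measurable_pair_RV.

End pair_RV.

(** The convolution unfolds to the integral over [y] of [\d_x (A - y)], that is,
    of the indicator of [y + x] in [A]. *)
Lemma convolution_dirac (mu : probability DX R) (x : DX) (A : set DX) :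
  convolution mu \d_x A = mu ((fun y => y + x) @^-1` A).
Proof.
rewrite /convolution /pushforward /product_measure1.
rewrite -[X in mu X]setIT -integral_indic//.
apply: eq_integral => y _ /=; rewrite diracE indicE.
congr ((nat_of_bool _)%:R%:E).
by apply/idP/idP; rewrite !inE /xsection/= ?inE.
Qed.

Lemma uniform_on_haar (U : {RV P >-> DX}) (K : {fset DX}) :
  uniform_on U K -> distribution P U = haar K :> (set DX -> \bar R).
Proof.
move=> UK; apply/funext => A.
pose F : {fset DX} := [fset x in K | x \in A]%fset.
have -> : distribution P U A =
    P (U @^-1` [set` F]
       `|` U @^-1` (A `\` [set` K])).
  congr (P _); apply/seteqP; split=> w /=.
    move=> Aw; have [wK|wK] := boolP (U w \in K); [left|right].
      by rewrite !inE wK/= mem_set.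
    by split=> //; apply/negP.
  by case=> [|[]//]; rewrite !inE => /andP[_ /set_mem].
rewrite measureU; last 3 first.
- exact: measurable_RV.
- exact: measurable_RV.
- apply/seteqP; split=> w //= []; rewrite !inE => /andP[wK _] [_]; exact.
rewrite [X in (_ + X)%E]prob_off_supp ?adde0; last first.
  by move=> x [_ /= xK]; rewrite (uniform_on_gt0 _ UK).
transitivity (\sum_(x <- F) atom U x)%:E; first exact: prob_fset.
rewrite /haar /F big_fset/= sumEFin -EFinM; congr (_%:E).
rewrite big_mkcond/= mulr_sumr big_seq [RHS]big_seq; apply: eq_bigr => x xK.
by rewrite indicE UK xK; case: (x \in A); rewrite ?mulr1 ?mul1r ?mulr0.
Qed.

(** [U - x0] is uniform on the translated set. *)
Lemma uniform_on_coset (U : {RV P >-> DX}) (S : {fset DX}) (x0 : DX) :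
    uniform_on U S ->
  distribution P U = convolution (haar [fset x - x0 | x in S]%fset) \d_x0
    :> (set DX -> \bar R).
Proof.
move=> US; set K := [fset _ | _ in _]%fset.
pose V : {RV P >-> DX} := pair_RV U U (fun x _ => x - x0).
have KS : #|` K| = #|` S| by rewrite card_imfset//=; exact: addIr.
have <- : distribution P V = haar K :> (set DX -> \bar R).
  apply: uniform_on_haar => k; rewrite KS.
  have -> : (k \in K) = (k + x0 \in S).
    apply/imfsetP/idP => [[x /= xS ->]|kS]; first by rewrite subrK.
    by exists (k + x0); rewrite //= addrK.
  rewrite -US; congr (fine (P _)); apply/seteqP; split=> w /=.
    by rewrite /pair_RV => <-; rewrite subrK.
  by rewrite /pair_RV => ->; rewrite addrK.
apply/funext => A; rewrite convolution_dirac; congr (P _).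
by apply/seteqP; split=> w /=; rewrite /pair_RV subrK.
Qed.

End random_variables.

(** * Symmetric conditional distributions *)

Theorem theorem1 (R : realType) (X : countZmodType)
    (X_no2 : ~ exists x : X, x != 0 /\ x *+ 2 = 0)
    (alpha : {additive discrete X -> discrete X})
    (alpha_aut : bijective alpha)
    (alpha_ker : (idfun \+ alpha) @^-1` [set 0] = [set 0])
    (d : measure_display) (Omega : measurableType d) (P : probability Omega R)
    (xi1 xi2 : {RV P >-> discrete X})
    (xi_indep : independent_RV P xi1 xi2)
    (L_sym : cond_symmetric P (xi1 \+ (alpha \o xi2)) (xi1 \+ xi2)) :
  exists (K : {fset discrete X}) (x1 x2 : discrete X),
    [/\ zmod_closed [in K],
        distribution P xi1 = convolution (haar K) \d_x1,
        distribution P xi2 = convolution (haar K) \d_x2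
      & [fset alpha x | x in K]%fset = K].
Proof.
have tors (x : discrete X) : x *+ 2 = 0 -> x = 0.
  move=> x2; apply: contrapT => /eqP x0; apply: X_no2; by exists x.
have dblI : injective (fun x : discrete X => x *+ 2).
  move=> x y /= xy; apply/eqP; rewrite -subr_eq0; apply/eqP/tors.
  by rewrite mulrnBl xy subrr.
have alphaI : injective alpha by exact: bij_inj.
have psiI : injective (fun x : discrete X => x + alpha x).
  move=> x y /= xy; apply/eqP; rewrite -subr_eq0; apply/eqP.
  have : ((idfun \+ alpha) @^-1` [set 0]) (x - y).
    by rewrite /= raddfB addrACA -opprD xy subrr.
  by rewrite alpha_ker.
have sym (B : set (discrete X * discrete X)) :
    P ((fun w => (xi1 w + xi2 w, xi1 w + alpha (xi2 w))) @^-1` B) =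
    P ((fun w => (xi1 w + xi2 w, - (xi1 w + alpha (xi2 w)))) @^-1` B).
  exact: (cond_symmetricP (pair_RV xi1 xi2 +%R)
    (pair_RV xi1 xi2 (fun x y => x + alpha y))).1.
have indep' : independent_RV P xi2 xi1.
  by move=> A B mA mB; rewrite setIC xi_indep// muleC.
(* These come from [L1 - L2] and [alpha L1 - L2] respectively. *)
pose phi1 (x : discrete X) : discrete X := x *+ 2.
pose phi2 (x : discrete X) : discrete X := alpha x *+ 2.
have law2 : same_law P ((fun y => y - alpha y) \o xi2)
    (fun w => phi1 (xi1 w) + (xi2 w + alpha (xi2 w))).
  move=> z; have := sym [set u | u.1 - u.2 = z].
  have e1 x y : x + y - (x + alpha y) = y - alpha y.
    by rewrite opprD addrACA subrr add0r.
  have e2 x y : x + y + (x + alpha y) = phi1 x + (y + alpha y).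
    by rewrite addrACA -mulr2n.
  rewrite (_ : _ @^-1` _ = ((fun y => y - alpha y) \o xi2) @^-1` [set z]).
    by move=> ->; congr (P _); apply/seteqP; split=> w /=; rewrite opprK e2.
  by apply/seteqP; split=> w /=; rewrite e1.
have law1 : same_law P ((fun x => alpha x - x) \o xi1)
    (fun w => phi2 (xi2 w) + (xi1 w + alpha (xi1 w))).
  move=> z; have := sym [set u | alpha u.1 - u.2 = z].
  have e1 x y : alpha (x + y) - (x + alpha y) = alpha x - x.
    by rewrite raddfD opprD addrACA subrr addr0.
  have e2 x y : alpha (x + y) + (x + alpha y) = phi2 y + (x + alpha x).
    rewrite raddfD /phi2 mulr2n [LHS]addrACA addrC; congr (_ + _).
    exact: addrC.
  rewrite (_ : _ @^-1` _ = ((fun x => alpha x - x) \o xi1) @^-1` [set z]).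
    by move=> ->; congr (P _); apply/seteqP; split=> w /=; rewrite opprK e2.
  by apply/seteqP; split=> w /=; rewrite e1.
have phi2I : injective phi2 by move=> x y /dblI/alphaI.
have phi1A x y z : phi1 (x - y + z) = phi1 x - phi1 y + phi1 z.
  by rewrite /phi1 mulrnDl mulrnBl.
have phi2A x y z : phi2 (x - y + z) = phi2 x - phi2 y + phi2 z.
  by rewrite /phi2 raddfD raddfB mulrnDl mulrnBl.
have [x0 x0_gt0 x0_max] := atom_max_ex xi1.
have [y0 y0_gt0 y0_max] := atom_max_ex xi2.
have [S [T [ST US UT]]] := uniform_pair x0_gt0 y0_gt0 x0_max y0_max
  (card_supp_le xi_indep dblI psiI law2 y0_max)
  (card_supp_le indep' phi2I psiI law1 x0_max).
have affS := supp_affine xi_indep dblI psiI law2 phi1A US UT ST.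
have affT := supp_affine indep' phi2I psiI law1 phi2A UT US (esym ST).
have x0S : x0 \in S by rewrite -(uniform_on_gt0 _ US).
have y0T : y0 \in T by rewrite -(uniform_on_gt0 _ UT).
(* The supports of [(L1, L2)] and [(L1, - L2)] coincide. *)
have supp_sym x y : x \in S -> y \in T -> exists x' y' : discrete X,
    [/\ x' \in S, y' \in T, x + y = x' + y' &
        x + alpha y = - (x' + alpha y')].
  rewrite -(uniform_on_gt0 _ US) -(uniform_on_gt0 _ UT) => xS yT.
  pose B := [set u : discrete X * discrete X | u = (x + y, x + alpha y)].
  have : (0 < P ((fun w =>
      (xi1 w + xi2 w, xi1 w + alpha (xi2 w))%R) @^-1` B))%E.
    exact: (pair_gt0 (B := [set z | B (z.1 + z.2, z.1 + alpha z.2)])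
      xi_indep xS yT).
  rewrite sym => /(@prob_gt0_atoms _ _ _ _ P xi1 xi2
    [set z | B (z.1 + z.2, - (z.1 + alpha z.2))]).
  move=> [x' [y' [[/= <- <-] xS' yT']]]; exists x', y'.
  by rewrite -(uniform_on_gt0 _ US) -(uniform_on_gt0 _ UT).
set K := [fset x - x0 | x in S]%fset.
set L := [fset y - y0 | y in T]%fset.
have subK : zmod_closed [in K] by exact: translate_zmod_closed.
have KL : #|` K| = #|` L| by rewrite !card_imfset//=; exact: addIr.
have split_K : {in K, forall k, exists a b : discrete X,
    [/\ a \in K, b \in L, k = a + b & k = - (a + alpha b)]}.
  move=> _ /imfsetP[x /= xS ->].
  (* The base point [(x0, y0)] has a reflection [(a0, b0)] of its own; measuring
     the reflection of [(x, y0)] from it gets rid of the translations. *)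
  have [a0 [b0 [a0S b0T e0 e0']]] := supp_sym _ _ x0S y0T.
  have [a [b [aS bT e e']]] := supp_sym _ _ xS y0T.
  exists (a - a0), (b - b0); split.
  - apply/imfsetP; exists (a - a0 + x0); first exact: affS.
    by rewrite addrK.
  - apply/imfsetP; exists (b - b0 + y0); first exact: affT.
    by rewrite addrK.
  - by rewrite addrACA -opprD -e -e0 opprD addrACA subrr addr0.
  - have -> : x - x0 = (x + alpha y0) - (x0 + alpha y0).
      by rewrite opprD addrACA subrr addr0.
    by rewrite e' e0' raddfB [in RHS]addrACA -!opprD.
have [LK alphaK] := subgroups_eq_stable KL alphaI tors subK split_K.
exists K, x0, y0; split=> //; first exact: uniform_on_coset.
by rewrite -LK; exact: uniform_on_coset.
Qed.
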